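(* Let $(X,\tau)$ be a noncompact metrizable space, let $a\in X$, let $d$ be a metric compatible with $\tau$, let $D=\{x_n:n\in\mathbb N\}\subseteq X\setminus\{a\}$ be a countably infinite $\tau$-closed discrete set, and let $(\lambda_n)_{n\ge1}$ be a sequence of real numbers with $\lambda_n>0$ and $\lambda_n\to0$. Define, for $x,y\in X$, $$h(x)=\inf_{n\ge1}\{\lambda_n+d(x,x_n)\},\qquad g(x)=\min\{d(x,a),h(x)\},\qquad p(x,y)=\min\{d(x,y),\,g(x)+g(y)\}.$$ Then $p$ is the greatest element, in the pointwise order, of the set of all metrics $r$ on $X$ satisfying $$r\le d,\qquad r(a,x_n)\le\lambda_n\quad\text{for all }n\in\mathbb N.$$ (That is, $p$ is itself a metric satisfying these conditions, and every metric $r$ satisfying them has $r(x,y)\le p(x,y)$ for all $x,y\in X$.)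
   Context: $\mathbb N=\{1,2,\ldots\}$. A metric is compatible with a topology if it induces it. A set is closed discrete if it is closed in the ambient space and has the discrete subspace topology. The enumeration $\{x_n:n\in\mathbb N\}$ is without repetitions. Inequalities between metrics are pointwise. *)

(* Defs.v *)
From HB Require Import structures.
From mathcomp Require Import all_boot all_order all_algebra.
From mathcomp Require Import all_classical all_reals all_analysis.

Set Implicit Arguments.
Unset Strict Implicit.
Unset Printing Implicit Defensive.

Import Order.TTheory GRing.Theory Num.Theory.
Import numFieldNormedType.Exports.

Local Open Scope classical_set_scope.
Local Open Scope ring_scope.

(* Several metrics on one carrier have to be compared, so the bundled
   [metricType] of the library cannot be used. *)
Record is_metric (R : realType) (X : Type) (d : X -> X -> R) : Prop := IsMetric {
  metric_nonneg : forall x y, 0 <= d x y ;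
  metric_eq0 : forall x y, d x y = 0 <-> x = y ;
  metric_symm : forall x y, d x y = d y x ;
  metric_tri : forall x y z, d x z <= d x y + d y z
}.

Definition compatible_metric (R : realType) (X : topologicalType)
    (d : X -> X -> R) : Prop :=
  is_metric d /\
  forall U : set X, open U <->
    forall z, U z -> exists2 e : R, 0 < e & [set y | d z y < e] `<=` U.

(* [set_type A] carries the subspace topology induced by its ambient space. *)
Definition closed_discrete (X : topologicalType) (A : set X) : Prop :=
  closed A /\ forall B : set (set_type A), open B.

Section Construction.
Context (R : realType) (X : Type).
Context (d : X -> X -> R) (a : X) (x : nat -> X) (lam : nat -> R).

(* Sequences are indexed from 0: [x n] and [lam n] stand for the terms of index
   n + 1.  The infimum is over a nonempty set, bounded below by 0 when d and lam
   are nonnegative, so [inf] is a genuine infimum and not a default value. *)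
Definition h_fun (y : X) : R := inf [set lam n + d y (x n) | n in [set: nat]].

Definition g_fun (y : X) : R := Num.min (d y a) (h_fun y).

Definition p_fun (y z : X) : R := Num.min (d y z) (g_fun y + g_fun z).

(* The metrics r need not be compatible with any given topology. *)
Definition admissible_metrics : set (X -> X -> R) :=
  [set r | [/\ is_metric r, (forall y z, r y z <= d y z)
             & forall n, r a (x n) <= lam n]].

End Construction.

Definition is_greatest_fun (R : realType) (X : Type)
    (A : set (X -> X -> R)) (p : X -> X -> R) : Prop :=
  A p /\ forall r, A r -> forall y z, r y z <= p y z.

(* Main.v *)
Require Import Defs.
From HB Require Import structures.
From mathcomp Require Import all_boot all_order all_algebra.
From mathcomp Require Import all_classical all_reals all_analysis.
From mathcomp Require Import lra.

Set Implicit Arguments.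
Unset Strict Implicit.
Unset Printing Implicit Defensive.

Import Order.TTheory GRing.Theory Num.Theory.
Import numFieldNormedType.Exports.

Local Open Scope classical_set_scope.
Local Open Scope ring_scope.

(** The value [g y] bounds the [r]-distance from [y] to [a] for every
    admissible [r]: go to [a] directly, at cost [d y a], or go to some [x n] at
    cost [d y (x n)] and jump to [a] at cost [lam n].  So [p y z] is the cheaper
    of the direct distance and a detour through [a], and no admissible metric
    exceeds it ([admissible_le_g_fun] and one triangle inequality).

    It remains to see that [p] is admissible.  The two constraints are read off
    from [g a = 0] and [g (x n) <= h (x n) <= lam n].  That [p] is a metric
    follows from a general principle ([metric_min_detour]): the minimum of a
    metric and a detour cost [g y + g z] is a metric as soon as [g] is
    nonnegative, 1-Lipschitz and vanishes at no more than one point.  Here [g] is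
    1-Lipschitz as a minimum of 1-Lipschitz functions, and it vanishes only at
    [a] because [h] is positive everywhere.  This positivity ([h_fun_gt0]) is the
    one step where the topology enters: as the [x n] are distinct and form a
    closed discrete set, every point [y] has a ball that contains no [x n]
    other than possibly [y] itself, so the terms [lam n + d y (x n)] are bounded
    below by a positive constant. *)

(** If the cheapest routes from [y1] to [y2] and from [y2] to [y3] are one
    direct and one detour, the Lipschitz condition moves the detour to the outer
    endpoints; if both are detours, dropping [2 * g y2 >= 0] suffices.  The
    condition on the zeros of [g] is what separates points. *)
Lemma metric_min_detour (R : realType) (X : Type) (d : X -> X -> R)
    (g : X -> R) :
  is_metric d -> (forall y, 0 <= g y) ->
  (forall y z, g y <= d y z + g z) ->
  (forall y z, g y = 0 -> g z = 0 -> y = z) ->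
  is_metric (fun y z => Num.min (d y z) (g y + g z)).
Proof.
move=> [d0 deq dsym dtri] g0 glip gsep; split.
- by move=> y z; rewrite le_min d0 addr_ge0.
- move=> y z; split=> [|->]; last first.
    by rewrite (deq z z).2 // min_l // addr_ge0.
  case: leP => _; first by move/deq.
  move/eqP; rewrite paddr_eq0 // => /andP[/eqP gy /eqP gz].
  exact: gsep.
- by move=> y z; rewrite dsym addrC.
- move=> y1 y2 y3.
  have := dtri y1 y2 y3; have := glip y1 y2; have := glip y3 y2.
  rewrite (dsym y3) ge_min; have := g0 y2.
  by case: (leP (d y1 y2)) => _; case: (leP (d y2 y3)) => _ *;
    apply/orP; (by left; lra) || (by right; lra).
Qed.

Lemma closed_discrete_isolated (R : realType) (X : topologicalType)
    (d : X -> X -> R) (A : set X) :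
  compatible_metric d -> closed_discrete A ->
  forall y, exists2 e : R, 0 < e & forall z, A z -> z <> y -> e <= d y z.
Proof.
move=> [_ dopen] [Acl Adisc] y.
have [Ay|nAy] := pselect (A y).
- pose ya : set_type A := SigSub (mem_set Ay).
  have [U oU Uy] := Adisc [set ya].
  have Uy_in : U y.
    by have : (set_val @^-1` U) ya by rewrite Uy.
  have [e e0 eU] := (dopen U).1 oU y Uy_in.
  exists e => // z Az zy; rewrite leNgt; apply/negP => dyz; apply: zy.
  have : (set_val @^-1` U) (SigSub (mem_set Az) : set_type A) by exact: eU.
  by rewrite Uy => /(congr1 set_val).
- have [e e0 eA] := (dopen (~` A)).1 (closed_openC Acl) y nAy.
  exists e => // z Az _; rewrite leNgt; apply/negP => dyz.
  exact: eA Az.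
Qed.

Section Detour.
Context (R : realType) (X : Type) (d : X -> X -> R) (a : X) (x : nat -> X).
Context (lam : nat -> R).
Hypotheses (dm : is_metric d) (lam_gt0 : forall n, 0 < lam n).

Lemma le_h_fun c y :
  (forall n, c <= lam n + d y (x n)) -> c <= h_fun d x lam y.
Proof.
move=> cle; apply: lb_le_inf; first by exists (lam 0%N + d y (x 0%N)), 0%N.
by move=> _ [n _ <-].
Qed.

Lemma h_fun_le y n : h_fun d x lam y <= lam n + d y (x n).
Proof.
apply: ge_inf; last by exists n.
exists 0 => _ [m _ <-].
by rewrite addr_ge0 ?(ltW (lam_gt0 _)) ?(metric_nonneg dm).
Qed.

Lemma h_fun_lipschitz y z : h_fun d x lam y <= d y z + h_fun d x lam z.
Proof.
rewrite -lerBlDl; apply: le_h_fun => n.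
have := h_fun_le y n; have := metric_tri dm y z (x n); lra.
Qed.

Lemma g_fun_ge0 y : 0 <= g_fun d a x lam y.
Proof.
rewrite le_min (metric_nonneg dm) le_h_fun // => n.
by rewrite addr_ge0 ?(ltW (lam_gt0 _)) ?(metric_nonneg dm).
Qed.

Lemma g_fun_lipschitz y z :
  g_fun d a x lam y <= d y z + g_fun d a x lam z.
Proof.
have := metric_tri dm y z a; have := h_fun_lipschitz y z.
rewrite /g_fun ge_min.
by case: (leP (d z a)) => _ *; apply/orP; (by left; lra) || (by right; lra).
Qed.

Lemma g_fun_base : g_fun d a x lam a = 0.
Proof.
apply/eqP; rewrite eq_le g_fun_ge0 andbT ge_min.
by rewrite (metric_eq0 dm a a).2 ?lexx.
Qed.

Lemma g_fun_seq n : g_fun d a x lam (x n) <= lam n.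
Proof.
rewrite ge_min; apply/orP; right.
by have := h_fun_le (x n) n; rewrite (metric_eq0 dm _ _).2 // addr0.
Qed.

Lemma admissible_le_g_fun r y :
  admissible_metrics d a x lam r -> r y a <= g_fun d a x lam y.
Proof.
move=> [rm rd rlam]; rewrite le_min rd /=; apply: le_h_fun => n.
have := metric_tri rm y (x n) a; have := rd y (x n); have := rlam n.
by rewrite (metric_symm rm a); lra.
Qed.

End Detour.

(** Injectivity of [x] ensures that at most one index [m] has [x m = y]; that
    term is at least [lam m], and all the others are at least the isolation
    radius of [y]. *)
Lemma h_fun_gt0 (R : realType) (X : topologicalType) (d : X -> X -> R)
    (x : nat -> X) (lam : nat -> R) :
  compatible_metric d -> injective x -> closed_discrete (range x) ->
  (forall n, 0 < lam n) -> forall y, 0 < h_fun d x lam y.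
Proof.
move=> dc xinj xcd lam_gt0 y; have [dm _] := dc.
have d0 := metric_nonneg dm.
have [e e0 he] := closed_discrete_isolated dc xcd y.
have far n : x n <> y -> e <= lam n + d y (x n).
  by move=> /(he _ (imageT _ _)) /le_trans; apply; rewrite lerDr ltW.
have [[m xm]|ym] := pselect (exists m, x m = y).
- apply: (@lt_le_trans _ _ (Num.min e (lam m))); first by rewrite lt_min e0 /=.
  apply: le_h_fun => n; rewrite ge_min.
  have [->|nm] := eqVneq n m; first by rewrite lerDl d0 orbT.
  by rewrite far // -xm => /xinj /eqP; exact/negP.
- apply: (lt_le_trans e0); apply: le_h_fun => n.
  by apply: far => xn; apply: ym; exists n.
Qed.

Theorem proposition2p3 (R : realType) (X : topologicalType)
    (hX : ~ compact [set: X])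
    (a : X) (d : X -> X -> R) (hd : compatible_metric d)
    (x : nat -> X) (hxinj : injective x)
    (hxa : range x `<=` ~` [set a])
    (hD : closed_discrete (range x))
    (lam : nat -> R) (hlam0 : forall n, 0 < lam n)
    (hlam : lam n @[n --> \oo] --> 0) :
  is_greatest_fun (admissible_metrics d a x lam) (p_fun d a x lam).
Proof.
have dm := hd.1.
have g0_base y : g_fun d a x lam y = 0 -> y = a.
  rewrite /g_fun; case: leP => _; first by move/(metric_eq0 dm).
  by move=> hy; have := h_fun_gt0 hd hxinj hD hlam0 y; rewrite hy ltxx.
split; first split.
- apply: metric_min_detour => //.
  + exact: g_fun_ge0.
  + exact: g_fun_lipschitz.
  + by move=> y z /g0_base -> /g0_base ->.
- by move=> y z; rewrite ge_min lexx.
- move=> n; rewrite ge_min; apply/orP; right.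
  by rewrite g_fun_base // add0r g_fun_seq.
- move=> r r_adm y z; have [rm rd _] := r_adm.
  rewrite le_min rd /=; apply: (le_trans (metric_tri rm y a z)).
  by rewrite (metric_symm rm a z) lerD // admissible_le_g_fun.
Qed.
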